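(* Let $n\ge 2$, $X=\{x_1,\dots,x_n\}$, and let $FQ(X)$ be the free quandle on $X$. Let $<$ be a right order on $FQ(X)$ that satisfies neither of the following properties E1, E2: E1: for any $\hat q\in FQ(X)$ there exist $M,m\in FQ(X)$ such that for all $q\in FQ(X)$, $\hat q*m<\hat q*q<\hat q*M$; E2: for any $\hat q\in FQ(X)$ there exist $M,m\in FQ(X)$ such that for all $x_i^U,x_j^V\in FQ(X)$: $\hat q*M<\hat q*x_i^U<\hat q*x_j^V$ implies $i=j$, and $\hat q*x_i^U<\hat q*x_j^V<\hat q*m$ implies $i=j$. Then $<$ is not an isolated point of $RQ(FQ(X))$.
   Context: A quandle is a set with operation $*$ satisfying $q*q=q$, unique right division ($q=s*r$ has a unique solution $s$), and $(q*r)*s=(q*s)*(r*s)$. The free quandle $FQ(X)$: let $F(X)$ be the free group on $X$; elements are symbols $x^w$ with $x\in X$, $w\in F(X)$, modulo the equivalence relation generated by $x^w=x^{xw}$, with operation $x^w*y^v=x^{wv^{-1}yv}$. A right order on a quandle $Q$ is a total order with $q_1<q_2\Rightarrow q_1*q<q_2*q$ for all $q$. $RQ(Q)$ is the set of right orders with the topology induced from $\{-1,0,1\}^{Q^3}$ (product topology) by identifying $<$ with $c_<(q_1,q_2,q_3)=\mathrm{sgn}(\sigma)$ if $q_{\sigma(1)}<q_{\sigma(2)}<q_{\sigma(3)}$ and $0$ otherwise; equivalently, basic open sets are given by prescribing the order on finitely many pairs. *)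

(* Defs.v *)
From mathcomp Require Import all_boot.
Set Implicit Arguments. Unset Strict Implicit. Unset Printing Implicit Defensive.

Section FreeQuandle.
Variable n : nat.

(* a letter (i, true) is x_i, (i, false) is x_i^{-1} *)
Definition letter := ('I_n * bool)%type.
Definition linv (a : letter) : letter := (a.1, ~~ a.2).

Definition red_cons (a : letter) (w : seq letter) : seq letter :=
  if w is b :: w' then (if b == linv a then w' else a :: w) else [:: a].

Definition reduce (w : seq letter) : seq letter := foldr red_cons [::] w.

Definition winv (w : seq letter) : seq letter := rev (map linv w).

Fixpoint irred (w : seq letter) : bool :=
  match w with
  | a :: ((b :: _) as w') => (b != linv a) && irred w'
  | _ => true
  end.

(** * Free quandle FQ(X)
   Elements are symbols x_i^w (i, w) with w in F(X), modulo the equivalence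
   generated by x^w = x^{xw}; the class of x_i^w is {x_i^{x_i^k w} | k in Z}.
   We represent each class by its unique canonical representative: w reduced
   and not starting with a letter x_i^{+-1}. *)
Fixpoint strip (i : 'I_n) (w : seq letter) : seq letter :=
  if w is a :: w' then (if a.1 == i then strip i w' else w) else w.

Definition fq_canon (p : 'I_n * seq letter) : bool :=
  irred p.2 && (if p.2 is a :: _ then a.1 != p.1 else true).

Definition fq_norm (p : 'I_n * seq letter) : 'I_n * seq letter :=
  (p.1, strip p.1 (reduce p.2)).

Lemma irred_red_cons a w : irred w -> irred (red_cons a w).
Proof.
case: w => [|b w] //= H.
case: ifP => Hb; first by case: w H => [|c w] //= /andP[].
by rewrite /= Hb.
Qed.

Lemma irred_reduce w : irred (reduce w).
Proof. by elim: w => [|a w IH] //=; apply: irred_red_cons. Qed.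

Lemma irred_strip i w : irred w -> irred (strip i w).
Proof.
elim: w => [|a w IH] //= H.
case: ifP => _ //; apply: IH.
by case: w H => [|c w] //= /andP[].
Qed.

Lemma strip_head i w : if strip i w is a :: _ then a.1 != i else true.
Proof. by elim: w => [|a w IH] //=; case: ifP => //= ->. Qed.

Lemma fq_norm_canon p : fq_canon (fq_norm p).
Proof.
rewrite /fq_canon /fq_norm /= irred_strip ?irred_reduce //.
exact: strip_head.
Qed.

Definition FQ := {p : 'I_n * seq letter | fq_canon p}.

Definition fq_of (p : 'I_n * seq letter) : FQ :=
  exist _ (fq_norm p) (fq_norm_canon p).

Definition fq_idx (p : FQ) : 'I_n := (proj1_sig p).1.

Definition fq_op (p q : FQ) : FQ :=
  let: (i, w) := proj1_sig p in
  let: (j, v) := proj1_sig q in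
  fq_of (i, w ++ winv v ++ (j, true) :: v).

End FreeQuandle.

Definition right_order (Q : Type) (op : Q -> Q -> Q) (R : Q -> Q -> Prop) :=
  [/\ (forall x, ~ R x x),
      (forall x y z, R x y -> R y z -> R x z),
      (forall x y, x <> y -> R x y \/ R y x) &
      (forall x y q, R x y -> R (op x q) (op y q))].

(* R is an isolated point of RQ(Q): some basic open set (orders prescribed
   on finitely many pairs) contains R and no other right order. *)
Definition isolated_RQ (Q : Type) (op : Q -> Q -> Q) (R : Q -> Q -> Prop) :=
  exists (k : nat) (a b : 'I_k -> Q),
    (forall t, R (a t) (b t)) /\
    (forall R' : Q -> Q -> Prop, right_order op R' ->
       (forall t, R' (a t) (b t)) ->
       forall x y, R' x y <-> R x y).

Definition ord_le (Q : Type) (R : Q -> Q -> Prop) (a b : Q) := R a b \/ a = b.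

(* Property E1 (read with non-strict inequalities) *)
Definition propE1 (n : nat) (R : FQ n -> FQ n -> Prop) :=
  forall qh : FQ n, exists M m : FQ n, forall q : FQ n,
    ord_le R (fq_op qh m) (fq_op qh q) /\ ord_le R (fq_op qh q) (fq_op qh M).

Definition propE2 (n : nat) (R : FQ n -> FQ n -> Prop) :=
  forall qh : FQ n, exists M m : FQ n, forall p q : FQ n,
    (R (fq_op qh M) (fq_op qh p) -> R (fq_op qh p) (fq_op qh q) ->
       fq_idx p = fq_idx q) /\
    (R (fq_op qh p) (fq_op qh q) -> R (fq_op qh q) (fq_op qh m) ->
       fq_idx p = fq_idx q).

(* Main.v *)
(** A right order on [FQ(X)] is an order on the right [F(X)]-set
    [\bigsqcup_i <x_i>\F(X)] that is invariant under [F(X)]. Conversely, order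
    automorphisms [A_i] of the rationals with points [p_i] fixed by [A_i] give
    an equivariant map from this set to the rationals, hence an invariant order.

    Finitely many inequalities of a right order [R] involve only a ball [B].
    Let [M] be its maximum; some generator [x_j^e] moves [M] upwards, to [N],
    which is outside [B]. Take [h <> j] and [d] with [N x_h^d > N]. Put the
    points of [B] and [N] at their ranks in the rationals and extend the partial
    actions of the generators on [B] and [N] to piecewise linear automorphisms.
    As the [h]-edges at [N] leave [B], the automorphism of [x_h^d] may be chosen
    to send [N] below itself. The resulting order agrees with [R] on [B] but not
    on the pair [(N, N x_h^d)]. *)
Require Import Defs.
From mathcomp Require Import all_boot all_order all_algebra.
From mathcomp Require Import boolp.
From mathcomp Require Import lra.

Set Implicit Arguments. Unset Strict Implicit. Unset Printing Implicit Defensive.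

Import Order.TTheory GRing.Theory Num.Theory.

(** * Extension of finite increasing partial maps to order automorphisms of an ordered field *)

Section PiecewiseLinear.
Variable F : realFieldType.
Local Open Scope ring_scope.

Definition order_aut (fg : (F -> F) * (F -> F)) :=
  [/\ cancel fg.1 fg.2, cancel fg.2 fg.1 & {mono fg.1 : x y / x < y}].

(** The kink at [e] leaves all values up to [e] untouched, so a single further value can be
    corrected by the choice of [c]. *)
Definition scale_above (e c x : F) : F := if x <= e then x else e + c * (x - e).

Lemma scale_aboveK (e c : F) : 0 < c ->
  cancel (scale_above e c) (scale_above e c^-1).
Proof.
move=> c0 x; rewrite /scale_above; case: (leP x e) => xe; first by rewrite xe.
rewrite gerDl leNgt mulr_gt0 ?subr_gt0 //=.
by rewrite addrAC subrr add0r mulKf ?gt_eqF // addrC subrK.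
Qed.

Lemma scale_above_mono (e c : F) : 0 < c ->
  {mono scale_above e c : x y / x < y}.
Proof.
move=> c0; apply: leW_mono; apply: le_mono => x y xy; rewrite /scale_above.
case: (leP x e) => xe; case: (leP y e) => ye //.
- by apply: (le_lt_trans xe); rewrite ltrDl mulr_gt0 // subr_gt0.
- by have := lt_trans xe xy; rewrite ltNge ye.
- by rewrite ltrD2l ltr_pM2l // ltrD2r.
Qed.

Definition lt_pair (p q : F * F) := (p.1 < q.1) && (p.2 < q.2).

Lemma lt_pair_trans : transitive lt_pair.
Proof.
move=> q p r /andP[a b] /andP[c d].
by rewrite /lt_pair (lt_trans a c) (lt_trans b d).
Qed.

(** Induction on the last point [q]: an automorphism [f] fitting the earlier points, the last of
    which is [p], is followed by a rescaling above [p.2] whose slope carries [f q.1] to [q.2]. *)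
Lemma sorted_order_aut (s : seq (F * F)) : sorted lt_pair s ->
  exists2 fg, order_aut fg & {in s, forall p, fg.1 p.1 = p.2}.
Proof.
rewrite (sorted_pairwise lt_pair_trans).
elim/last_ind: s => [_|s q IH]; first by exists (id, id).
rewrite pairwise_rcons => /andP[/allP sq sp].
have [[f g] [/= fK gK fm] fs] := IH sp.
case/lastP: s => [|s p] in sq sp fs {IH} *.
  exists (fun x => x - q.1 + q.2, fun x => x - q.2 + q.1).
    by split=> [x|x|x y] /=; rewrite ?addrK ?subrK // !ltrD2r.
  by move=> p; rewrite inE => /eqP -> /=; rewrite subrr add0r.
have ps : p \in rcons s p by rewrite mem_rcons mem_head.
have /andP[p1 p2] := sq p ps.
have fq : p.2 < f q.1 by rewrite -(fs p ps) fm.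
pose c := (q.2 - p.2) / (f q.1 - p.2).
have c0 : 0 < c by rewrite divr_gt0 // subr_gt0.
exists (scale_above p.2 c \o f, g \o scale_above p.2 c^-1).
  split=> [x|x|x y] /=; first by rewrite scale_aboveK.
    have {1}-> : c = c^-1^-1 by rewrite invrK.
    by rewrite gK scale_aboveK ?invr_gt0.
  by rewrite scale_above_mono.
move=> r; rewrite mem_rcons inE /= => /orP[/eqP->|rs].
  rewrite /scale_above leNgt fq /= /c mulfVK ?gt_eqF ?subr_gt0 //.
  by rewrite addrC subrK.
suff rp : r.2 <= p.2 by rewrite fs // /scale_above rp.
move: rs; rewrite mem_rcons inE => /orP[/eqP-> //|rs].
move: sp; rewrite pairwise_rcons => /andP[/allP/(_ r rs)/andP[_ /ltW]] //.
Qed.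

Definition order_compatible (s : seq (F * F)) :=
  {in s &, forall p q, (p.1 < q.1) = (p.2 < q.2)}.

Lemma order_compatible_cons (p : F * F) (s : seq (F * F)) :
  order_compatible s -> {in s, forall q, lt_pair q p} ->
  order_compatible (p :: s).
Proof.
move=> cs ps q r; rewrite !inE => /orP[/eqP->|qs] /orP[/eqP->|rs].
- by rewrite !ltxx.
- by have /andP[a b] := ps r rs; rewrite !ltNge !ltW.
- by have /andP[-> ->] := ps q qs.
- exact: cs.
Qed.

(** Compatibility makes distinct pairs differ in both coordinates, so sorting by the first
    coordinate without repetitions gives a list increasing in both. *)
Lemma order_compatible_aut (s : seq (F * F)) : order_compatible s ->
  exists2 fg, order_aut fg & {in s, forall p, fg.1 p.1 = p.2}.
Proof.
move=> cs; pose le1 : rel (F * F) := relpre fst <=%R.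
have le1_trans : transitive le1 by move=> q p r; apply: le_trans.
pose s' := sort le1 (undup s).
have s's p : (p \in s') = (p \in s) by rewrite mem_sort mem_undup.
have : sorted lt_pair s'.
  rewrite (sorted_pairwise lt_pair_trans).
  have : pairwise [rel p q | le1 p q && (p != q)] s'.
    rewrite pairwise_relI -sorted_pairwise // -uniq_pairwise.
    rewrite sort_uniq undup_uniq andbT; apply: sort_sorted => p q.
    exact: le_total.
  apply: (@sub_in_pairwise _ (mem s)) => [p q ps qs|]; last first.
    by apply/allP => p; rewrite s's.
  case/andP; rewrite /le1 /= le_eqVlt => /orP[/eqP e|lt12 _].
    case/negP; rewrite -pair_eqE /= e eqxx eq_le !leNgt.
    by rewrite -!cs ?e ?ltxx.
  by rewrite /lt_pair -cs // lt12.
move=> /sorted_order_aut[fg au fgs]; exists fg => // p ps.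
by apply: fgs; rewrite s's.
Qed.

End PiecewiseLinear.

(** * The free group acting on the free quandle by right multiplication *)

Section FreeQuandleAction.
Variable n : nat.
Implicit Types (a b : letter n) (w v : seq (letter n)) (t u : FQ n) (i j : 'I_n).

Definition fq_gen i : FQ n := fq_of (i, [::]).

(** The coset $\langle x_i\rangle w$ is sent to $\langle x_i\rangle wa$; quandle multiplication by
    the generator $x_j$ is the case $a = x_j$. *)
Definition fq_act t a : FQ n := fq_of ((val t).1, rcons (val t).2 a).

Lemma linvK : involutive (@linv n).
Proof. by case=> i b; rewrite /linv /= negbK. Qed.

Lemma reduce_irred w : irred w -> reduce w = w.
Proof.
elim: w => [|a w IH] //=; case: w IH => [|b w] // IH /andP[ba ib].
by rewrite IH //= (negbTE ba).
Qed.

Lemma irred_rconsl w a : irred (rcons w a) -> irred w.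
Proof.
elim: w => [|b w IH] //=; case: w IH => [|c w] //= IH /andP[-> ?].
exact: IH.
Qed.

Lemma irred_rcons w a : irred w -> last a w != linv a -> irred (rcons w a).
Proof.
elim: w => [|b w IH] //=; case: w IH => [|c w] /= IH.
  by rewrite andbT -(inj_eq (can_inj linvK)) linvK eq_sym.
by case/andP=> -> ic la /=; apply: IH.
Qed.

Lemma fq_normK p : fq_canon p -> @fq_norm n p = p.
Proof.
case: p => i w /andP[/= iw hw]; rewrite /fq_norm /= reduce_irred //.
by case: w hw {iw} => [|a w] //= /negbTE ->.
Qed.

Lemma val_fq_of p : fq_canon p -> val (@fq_of n p) = p.
Proof. exact: fq_normK. Qed.

Lemma fq_of_val t : fq_of (val t) = t.
Proof. by apply: val_inj; rewrite /= fq_normK //; case: t. Qed.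

Lemma fq_canon_rconsl i w a : fq_canon (i, rcons w a) -> fq_canon (i, w).
Proof.
by case/andP=> /= /irred_rconsl iw h; rewrite /fq_canon iw; case: w h {iw}.
Qed.

Lemma reduce_rconsK w a : reduce (rcons (rcons w a) (linv a)) = reduce w.
Proof. by rewrite /reduce !foldr_rcons /= eqxx. Qed.

(* [FqActFix] is the loop at the base point [x_i] of the Schreier graph of
   [<x_i>]; the other two cases are the edges of a tree. *)
Variant fq_act_spec t a : FQ n -> Type :=
| FqActExtend u of val u = ((val t).1, rcons (val t).2 a) : fq_act_spec t a u
| FqActFix of (val t).2 = [::] & a.1 = (val t).1 : fq_act_spec t a t
| FqActCancel u of val t = ((val u).1, rcons (val u).2 (linv a)) :
    fq_act_spec t a u.

(** Appending [a] keeps a canonical word canonical unless [a] cancels the last letter, or the word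
    is empty and [a] is $x_i^{\pm 1}$ for the base index $i$. *)
Lemma fq_actP t a : fq_act_spec t a (fq_act t a).
Proof.
case: t => -[i w] ct; rewrite /fq_act /=.
case/lastP: w => [|w b] in ct *.
  case: (eqVneq a.1 i) => ai.
    suff -> : fq_of (i, [:: a]) = exist _ (i, [::]) ct by exact: FqActFix.
    by apply: val_inj; rewrite /= /fq_norm /= ai eqxx.
  by apply: FqActExtend; rewrite val_fq_of // /fq_canon /= ai.
case: (eqVneq b (linv a)) => ba.
  suff e : val (fq_of (i, rcons (rcons w b) a)) = (i, w).
    by apply: FqActCancel; rewrite e /= -ba.
  have := reduce_rconsK w b; rewrite {2}ba linvK /= /fq_norm /= => ->.
  exact: (fq_normK (fq_canon_rconsl ct)).
apply: FqActExtend; rewrite val_fq_of //; case/andP: (ct) => /= ic hc.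
rewrite /fq_canon /= irred_rcons ?last_rcons //.
by case: w ct ic hc.
Qed.

Lemma fq_actK t a : fq_act (fq_act t a) (linv a) = t.
Proof.
case: (fq_actP t a) => [u e|e ai|u e]; last by rewrite /fq_act -e fq_of_val.
  apply: val_inj; rewrite /= e /= /fq_norm /= reduce_rconsK.
  by case: t {e} => -[i w] ct; apply: fq_normK.
apply: val_inj; rewrite /= e /fq_norm /= ai eqxx.
by case: t e {ai} => -[i w] ct /= ->.
Qed.

Lemma fq_actVK t a : fq_act (fq_act t (linv a)) a = t.
Proof. by rewrite -{2}[a]linvK fq_actK. Qed.

Lemma fq_act_inj a : injective (fq_act^~ a).
Proof. by move=> t u e; rewrite -(fq_actK t a) e fq_actK. Qed.

Lemma fq_act_gen i : fq_act (fq_gen i) (i, true) = fq_gen i.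
Proof. by apply: val_inj; rewrite /= /fq_norm /= eqxx. Qed.

Lemma size_fq_act t a : size (val (fq_act t a)).2 <= (size (val t).2).+1.
Proof.
case: fq_actP => [u ->|_ _|u ->] /=; rewrite ?size_rcons //.
by rewrite ltnW // ltnW.
Qed.

Lemma fq_act_neq t a : a.1 != (val t).1 -> fq_act t a <> t.
Proof.
case: fq_actP => [u e _ ut|_ ->|u e _ ut]; last 2 first.
- by rewrite eqxx.
- by have := congr1 (size \o snd) e; rewrite /= ut size_rcons => /n_Sn.
by have := congr1 (size \o snd) e; rewrite /= ut size_rcons => /n_Sn.
Qed.

Lemma fq_opE t u :
  fq_op t u = fq_of ((val t).1,
    (val t).2 ++ winv (val u).2 ++ ((val u).1, true) :: (val u).2).
Proof. by case: t u => -[i w] ? [[j v] ?]. Qed.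

Lemma fq_op_gen t j : fq_op t (fq_gen j) = fq_act t (j, true).
Proof. by rewrite fq_opE /fq_act -cats1. Qed.

Lemma fq_ball (L : nat) :
  exists s : seq (FQ n), forall t, (t \in s) = (size (val t).2 <= L).
Proof.
have [W WL] : exists W : seq (seq (letter n)),
    forall w, (w \in W) = (size w <= L).
  elim: L => [|L [W WL]]; first by exists [:: [::]] => -[].
  exists ([::] :: [seq a :: w | a <- enum {: letter n}, w <- W]) => w.
  rewrite inE; case: w => [|a w] //=; rewrite ltnS -WL.
  apply/allpairsP/idP => [[[b v] /= [_ vW [_ ->]]] //|wW].
  by exists (a, w); rewrite mem_enum.
exists (pmap insub [seq (i, w) | i <- enum 'I_n, w <- W]) => t.
rewrite mem_pmap_sub -WL.
apply/allpairsP/idP => [[[i v] /= [_ vW ->]] //|tW].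
by exists (val t); rewrite mem_enum tW -surjective_pairing.
Qed.

(** * Right orders as orders invariant under the action *)

Section RightOrder.
Variable R : FQ n -> FQ n -> Prop.
Hypothesis oR : right_order (@fq_op n) R.

Lemma right_order_asym t u : R t u -> R u t -> False.
Proof. by case: oR => irr tr _ _ tu ut; apply: (irr t); apply: tr tu ut. Qed.

(** Invariance is given for positive letters only; totality and injectivity of the action extend it
    to inverse letters and to the converse implication. *)
Lemma right_order_act a t u : R (fq_act t a) (fq_act u a) <-> R t u.
Proof.
have [irr tr tot inv] := oR.
have pos j t' u' : R t' u' -> R (fq_act t' (j, true)) (fq_act u' (j, true)).
  by rewrite -!fq_op_gen; exact: inv.
have act t' u' : R t' u' -> R (fq_act t' a) (fq_act u' a).
  case: a => j [] tu; first exact: pos.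
  have [/fq_act_inj e|//|/(pos j)] :
      [\/ fq_act t' (j, false) = fq_act u' (j, false),
      R (fq_act t' (j, false)) (fq_act u' (j, false)) |
      R (fq_act u' (j, false)) (fq_act t' (j, false))].
  - have [e|/eqP/tot[]] := eqVneq (fq_act t' (j, false)) (fq_act u' (j, false));
      by [constructor 1|constructor 2|constructor 3].
  - by case: (irr t'); rewrite {2}e.
  - by rewrite !(fq_actVK _ (j, true)) => /(right_order_asym tu).
split=> [tu|]; last exact: act.
have [e|/eqP/tot[//|/act]] := eqVneq t u.
  by case: (irr (fq_act t a)); rewrite {2}e.
by move/(right_order_asym tu).
Qed.

Lemma right_order_act_gt t j : fq_act t (j, true) <> t ->
  exists e, R t (fq_act t (j, e)).
Proof.
have [_ _ tot _] := oR.
case/tot=> [|lt]; last by exists true.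
by move/(right_order_act (j, false)); rewrite (fq_actK t (j, true)); exists false.
Qed.

Lemma right_order_max (s : seq (FQ n)) (t0 : FQ n) : t0 \in s ->
  exists2 M, M \in s & forall t, t \in s -> t = M \/ R t M.
Proof.
have [_ tr tot _] := oR.
case: s => // x s _; elim: s x => [|y s IH] x.
  by exists x; rewrite ?mem_head // => t; rewrite inE => /eqP; left.
have [M Ms Mmax] := IH y.
have [MxM|/eqP/tot[xM|Mx]] := eqVneq x M.
- exists M; first by rewrite inE Ms orbT.
  by move=> t; rewrite inE => /orP[/eqP->|/Mmax //]; left.
- exists M; first by rewrite inE Ms orbT.
  by move=> t; rewrite inE => /orP[/eqP->|/Mmax //]; right.
- exists x; first exact: mem_head.
  move=> t; rewrite inE => /orP[/eqP->|/Mmax [->|tM]]; [by left|by right|right].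
  exact: tr tM Mx.
Qed.

End RightOrder.

(** * Invariant orders obtained from actions on a totally ordered set *)

Section Pullback.
Variables (d : Order.disp_t) (T : orderType d).
Variables (A : letter n -> T -> T) (pt : 'I_n -> T).
Hypothesis AK : forall a, cancel (A a) (A (linv a)).
Hypothesis A_mono : forall a, {mono A a : x y / (x < y)%O}.
Hypothesis A_pt : forall i, A (i, true) (pt i) = pt i.

Let run w x := foldl (fun y a => A a y) x w.

Definition orbit_map t : T := run (val t).2 (pt (val t).1).

Lemma run_reduce w x : run (reduce w) x = run w x.
Proof.
elim: w x => [|a w IH] x //=; rewrite -IH.
case: (reduce w) => [|b v] //=; case: eqP => [->|] //=.
by rewrite AK.
Qed.

(** Leading letters $x_i^{\pm 1}$ fix the base point [pt i]; hence the orbit map does not depend on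
    the word representing a class. *)
Lemma run_strip i w : run (strip i w) (pt i) = run w (pt i).
Proof.
elim: w => [|[j e] w IH] //=; case: eqP => //= ->; rewrite IH; congr run.
by case: e; [rewrite A_pt | rewrite -{2}(A_pt i) (AK (i, true))].
Qed.

Lemma orbit_map_fq_of p : orbit_map (fq_of p) = run p.2 (pt p.1).
Proof. by rewrite /orbit_map /= run_strip run_reduce. Qed.

Lemma orbit_map_act t a : orbit_map (fq_act t a) = A a (orbit_map t).
Proof. by rewrite orbit_map_fq_of /run foldl_rcons. Qed.

Lemma run_mono w : {mono run w : x y / (x < y)%O}.
Proof. by elim: w => [|a w IH] x y //=; rewrite IH A_mono. Qed.

(* Ties are broken by [R], since the orbit map need not be injective. *)
Definition pullback (R : FQ n -> FQ n -> Prop) t u :=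
  (orbit_map t < orbit_map u)%O \/ orbit_map t = orbit_map u /\ R t u.

Lemma pullback_right_order R :
  right_order (@fq_op n) R -> right_order (@fq_op n) (pullback R).
Proof.
case=> irr tr tot inv; split.
- by move=> t [|[_ /irr //]]; rewrite ltxx.
- move=> t u v [tu|[tu Rtu]] [uv|[uv Ruv]].
  + by left; apply: lt_trans uv.
  + by left; rewrite -uv.
  + by left; rewrite tu.
  + by right; split; [rewrite tu | apply: tr Ruv].
- move=> t u ne; rewrite /pullback.
  case: (ltgtP (orbit_map t) (orbit_map u)) => [||e].
  - by left; left.
  - by right; left.
  - by have [] := tot _ _ ne; [left; right|right; right].
(* Multiplying by $x_j^v$ acts through the word $v^{-1} x_j v$, a composite of increasing maps. *)
- move=> t u q; rewrite /pullback !fq_opE !orbit_map_fq_of /= /run !foldl_cat.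
  rewrite -!/(run _ _) -!/(orbit_map _) /= => -[tu|[-> tu]].
    by left; rewrite !run_mono A_mono run_mono.
  by right; split=> //; rewrite -!fq_opE; exact: inv.
Qed.

End Pullback.
End FreeQuandleAction.

(** * Perturbation of a right order just outside a ball *)

Lemma ltn_count (T : eqType) (a1 a2 : pred T) (s : seq T) (x : T) :
  subpred a1 a2 -> x \in s -> ~~ a1 x -> a2 x -> count a1 s < count a2 s.
Proof.
move=> sub12 /path.splitPr[s1 s2] /negbTE a1x a2x.
rewrite !count_cat /= a1x a2x add0n addnCA add1n ltnS.
by rewrite leq_add ?sub_count.
Qed.

(* [N] lies just outside the ball of radius [L] and above it. Neither neighbour
   of [N] along the generator of [c] is in the ball, so the value of [c] at [N]
   is only constrained from below, by values at points of the ball. *)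
Section Perturbation.
Variables (n L : nat) (R : FQ n -> FQ n -> Prop) (N : FQ n) (c : letter n).
Hypothesis oR : right_order (@fq_op n) R.
Hypothesis ball_lt_N : forall t, size (val t).2 <= L -> R t N.
Hypothesis size_N : size (val N).2 = L.+1.
Hypothesis size_Nc : forall e, size (val (fq_act N (c.1, e))).2 = L.+2.

Lemma perturbed_right_order : exists R' : FQ n -> FQ n -> Prop,
  [/\ right_order (@fq_op n) R',
    forall t u, size (val t).2 <= L -> size (val u).2 <= L ->
      R t u -> R' t u &
    R' (fq_act N c) N].
Proof.
have [irr tr tot _] := oR.
have [B BL] := fq_ball n L.
pose T := N :: B.
have TL t : t \in T -> size (val t).2 <= L.+1.
  by rewrite inE BL => /orP[/eqP->|/leqW //]; rewrite size_N.
(* Ranks inside [T]: comparable points end up at distance at least 1, which leaves room for a new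
   value between [N] and the ball. *)
pose pos t : rat := (count (fun u => `[< R u t >]) T)%:R%R.
have pos_lt t u : t \in T -> R t u -> (pos t + 1 <= pos u)%R.
  move=> tT tu; rewrite /pos natr1 ler_nat; apply: ltn_count tT _ _.
  - by move=> v /asboolP vt; apply/asboolP; apply: tr tu.
  - by apply/asboolP; exact: irr.
  - exact/asboolP.
have posE : {in T &, forall t u, (pos t < pos u)%R = `[< R t u >]}.
  move=> t u tT uT; apply/idP/asboolP => [|/(pos_lt _ _ tT)]; last by lra.
  have [->|/eqP/tot[//|/(pos_lt _ _ uT)]] := eqVneq t u; first by rewrite ltxx.
  by lra.
(* The partial action of $x_j$ on [T]: only edges with both ends in [T] are prescribed. *)
pose P0 j := [seq (pos t, pos (fq_act t (j, true)))
             | t <- T & fq_act t (j, true) \in T].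
have P0P j p : p \in P0 j -> exists t,
    [/\ t \in T, fq_act t (j, true) \in T &
        p = (pos t, pos (fq_act t (j, true)))].
  by case/mapP=> t; rewrite mem_filter => /andP[? ?] ->; exists t.
have P0_compatible j : order_compatible (P0 j).
  move=> _ _ /P0P[t [tT taT ->]] /P0P[u [uT uaT ->]] /=.
  by rewrite !posE //; apply/asbool_equiv_eq; rewrite right_order_act.
(* The new value of [c] at [N]: above the ball, but below [N] itself. *)
pose m : rat := (pos N - 2^-1)%R.
have mN : (m < pos N)%R by rewrite /m; lra.
have Bm t : t \in B -> (pos t < m)%R.
  move=> tB; have := pos_lt t N _ (ball_lt_N _); rewrite inE tB orbT -BL tB.
  by move=> /(_ isT isT); rewrite /m; lra.
(* The graphs describe positive generators, so the pair is reversed when [c] is an inverse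
   letter. *)
pose q : rat * rat := if c.2 then (pos N, m) else (m, pos N).
pose P j := if j == c.1 then q :: P0 j else P0 j.
have P_compatible j : order_compatible (P j).
  rewrite /P; case: eqP => // ->; apply: order_compatible_cons => //.
  move=> _ /P0P[t [tT taT ->]].
  (* No edge of this generator inside [T] touches [N], so all its ends lie in the ball and have rank
     below [m]. *)
  have tB : t \in B.
    move: tT; rewrite inE => /orP[/eqP tN|//].
    by have := TL _ taT; rewrite tN size_Nc ltnn.
  have taB : fq_act t (c.1, true) \in B.
    move: taT; rewrite inE => /orP[/eqP tN|//].
    have := TL _ tT; rewrite -(fq_actK t (c.1, true)) tN.
    by rewrite (size_Nc false) ltnn.
  have {}tB := Bm _ tB; have {}taB := Bm _ taB.
  by rewrite /lt_pair /q; case: ifP => _ /=; apply/andP; split; lra.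
have [G G_aut G_P] :=
  fin_all_exists2 (fun j => order_compatible_aut (P_compatible j)).
pose A (a : letter n) := if a.2 then (G a.1).1 else (G a.1).2.
have AK a : cancel (A a) (A (linv a)).
  by case: a => j [] /=; have [] := G_aut j.
have A_mono a : {mono A a : x y / (x < y)%O}.
  case: a => j e; have [fK gK fm] := G_aut j; case: e => //= x y.
  by rewrite /A /= -fm !gK.
have A_pos t a : t \in T -> fq_act t a \in T -> A a (pos t) = pos (fq_act t a).
  have Apos u j : u \in T -> fq_act u (j, true) \in T ->
      A (j, true) (pos u) = pos (fq_act u (j, true)).
    move=> uT uaT; apply: (G_P j (pos u, pos (fq_act u (j, true)))).
    suff h : (pos u, pos (fq_act u (j, true))) \in P0 j.
      by rewrite /P; case: eqP => // _; rewrite inE h orbT.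
    by apply/mapP; exists u; rewrite // mem_filter uaT.
  case: a => j [] tT taT; first exact: Apos.
  have := Apos (fq_act t (j, false)) j taT; rewrite (fq_actVK t (j, true)).
  by move=> /(_ tT) <-; exact: (AK (j, true)).
pose pt i := pos (fq_gen i).
have genT i : fq_gen i \in T by rewrite inE BL orbT.
have A_pt i : A (i, true) (pt i) = pt i.
  by rewrite /pt A_pos ?fq_act_gen.
(* Induction on word length: dropping the last letter of a point of [T] gives a point of the ball,
   and the edge back is prescribed. *)
have orbitE t : t \in T -> orbit_map A pt t = pos t.
  have [k] := ubnP (size (val t).2); elim: k t => // k IH t sk tT.
  have [[i w] tE] : exists p, val t = p by exists (val t).
  case/lastP: w => [|w a] in tE *.
    suff -> : t = fq_gen i by [].
    by apply: val_inj.
  have ct : fq_canon (i, w).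
    by apply: (@fq_canon_rconsl _ _ _ a); rewrite -tE; case: (t).
  have uE := val_fq_of ct; set u := fq_of (i, w) in uE.
  have ut : fq_act u a = t by rewrite -(fq_of_val t) tE /fq_act uE.
  have {tE} st : size (val t).2 = (size w).+1 by rewrite tE size_rcons.
  have uT : u \in T by rewrite inE BL uE -ltnS -st TL ?orbT.
  rewrite -ut orbit_map_act // IH ?uE ?A_pos ?ut //.
  by rewrite -ltnS -st.
exists (pullback A pt R); split; first exact: pullback_right_order.
  move=> t u tL uL tu; left.
  have [tT uT] : t \in T /\ u \in T by rewrite !inE !BL tL uL !orbT.
  by rewrite !orbitE // posE //; apply/asboolP.
left; rewrite orbit_map_act // orbitE ?mem_head //.
have [GK _ _] := G_aut c.1.
have : (G c.1).1 q.1 = q.2 by apply: G_P; rewrite /P eqxx mem_head.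
by rewrite /q /A; case: c.2 => /= [->|fm] //; rewrite -{1}fm GK.
Qed.

End Perturbation.

Theorem theorem1p5 (n : nat) (hn : 2 <= n) (R : FQ n -> FQ n -> Prop) :
  right_order (@fq_op n) R -> ~ propE1 R -> ~ propE2 R ->
  ~ isolated_RQ (@fq_op n) R.
Proof.
move=> oR _ _ [k [a [b [Rab isoR]]]]; have [irr tr _ _] := oR.
have other (i : 'I_n) : exists j, j != i.
  case: (eqVneq i (Ordinal (ltnW hn))) => [->|ne]; last first.
    by exists (Ordinal (ltnW hn)); rewrite eq_sym.
  by exists (Ordinal hn).
pose len (t : FQ n) := size (val t).2.
(* A radius for which the ball contains every prescribed pair. *)
pose L := \max_(t < k) maxn (len (a t)) (len (b t)).
have abL t : len (a t) <= L /\ len (b t) <= L.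
  by apply/andP; rewrite -geq_max; exact: (leq_bigmax_cond (P := xpredT)).
have [B BL] := fq_ball n L.
have [M MB Mmax] : exists2 M, M \in B & forall t, t \in B -> t = M \/ R t M.
  by apply: (right_order_max oR (t0 := fq_gen (Ordinal (ltnW hn)))); rewrite BL.
(* Avoiding the base index of [M] excludes the loop, so $x_j$ moves [M]. *)
have [j jM] := other (val M).1.
have [e] := right_order_act_gt oR (@fq_act_neq _ M (j, true) jM).
set N := fq_act M (j, e) => MN.
have ltN t : len t <= L -> R t N.
  by rewrite -BL => /Mmax[->//|tM]; apply: tr MN.
have lenN : len N = L.+1.
  apply/eqP; rewrite eqn_leq; apply/andP; split.
    by apply: leq_trans (size_fq_act M (j, e)) _; rewrite ltnS -BL.
  by rewrite ltnNge; apply/negP => /ltN; exact: irr.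
(* The step from [M] to [N] leaves the ball, so it appends the letter [(j, e)]. *)
have valN : val N = ((val M).1, rcons (val M).2 (j, e)).
  move: MB lenN; rewrite BL /len /N.
  case: fq_actP => [u -> //|_ _|u -> /=]; first by move=> + e1; rewrite e1 ltnn.
  by rewrite size_rcons => /ltnW + e1; rewrite e1 ltnn.
have [h hj] := other j.
(* Since [h] differs from [j], no letter on [h] cancels the last letter of [N]; both [h]-edges lead
   further out. *)
have lenNh e' : len (fq_act N (h, e')) = L.+2.
  move: lenN; rewrite /len; case: fq_actP => [u -> /= <-|-> //|u uN _].
    by rewrite size_rcons.
  move: uN; rewrite valN => /(congr1 snd) /= /rcons_inj[_ jh _].
  by rewrite jh eqxx in hj.
have [|d Nd] := @right_order_act_gt _ _ oR N h.
  by move/(congr1 len); rewrite lenN lenNh => /esym/n_Sn.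
have [R' [oR' RR' R'N]] := perturbed_right_order (c := (h, d)) oR ltN lenN lenNh.
have R'ab t : R' (a t) (b t) by have [aL bL] := abL t; apply: RR'.
(* Isolation would transfer the inequality of [R'] at [N] to [R], against the choice of [d]. *)
by apply: (right_order_asym oR Nd); apply/(isoR R' oR' R'ab).
Qed.
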